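(* Let $X\subset\mathbb{R}$ be a compact interval of positive length and let $(M_n)$ be a weight sequence. Suppose that $\phi:X\to X$ induces a compact endomorphism of $D(X,M)$. If $x_0$ is the (unique) fixed point of $\phi$, then $|\phi'(x_0)|<1$.
   Context: A weight sequence is a sequence $(M_n)_{n\ge 0}$ of positive real numbers with $M_0=1$ and $\frac{M_{n+m}}{M_nM_m}\ge\binom{n+m}{m}$ for all non-negative integers $m,n$. For a compact interval $X\subset\mathbb{R}$ of positive length, $D(X,M)$ is the set of complex-valued infinitely differentiable functions $f$ on $X$ (one-sided derivatives at endpoints) with $\|f\|_D=\sum_{n=0}^\infty \frac{\|f^{(n)}\|_\infty}{M_n}<\infty$, where $\|\cdot\|_\infty$ is the supremum norm on $X$; with pointwise operations and the norm $\|\cdot\|_D$ it is a unital commutative semisimple Banach algebra. A map $\phi:X\to X$ induces an endomorphism of $D(X,M)$ if $f\circ\phi\in D(X,M)$ for every $f\in D(X,M)$; the endomorphism is then $T:f\mapsto f\circ\phi$ (automatically continuous), and $\phi$ induces a compact endomorphism if moreover $T$ is a compact operator. Since $f(x)=x$ lies in $D(X,M)$, such a $\phi$ automatically lies in $D(X,M)$, so $\phi'$ makes sense. It is a known fact that if $\phi$ induces a compact endomorphism then, with $\phi_n$ denoting the $n$-th iterate of $\phi$, $\bigcap_{n\ge0}\phi_n(X)=\{x_0\}$ for a point $x_0$ that is the unique fixed point of $\phi$. *)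

(* Defs.v *)
From HB Require Import structures.
From mathcomp Require Import all_boot all_order all_algebra.
From mathcomp Require Import all_classical all_reals all_analysis.
From mathcomp Require Import complex lra.

Set Implicit Arguments.
Unset Strict Implicit.
Unset Printing Implicit Defensive.

Import Order.TTheory GRing.Theory Num.Theory.
Import numFieldNormedType.Exports.

Local Open Scope classical_set_scope.
Local Open Scope ring_scope.
Local Open Scope complex_scope.

(* The complex numbers with the topology of the modulus. *)
HB.instance Definition _ (R : rcfType) := NormedModule.copy R[i] R[i]^o.

Record weight_sequence (R : realType) (M : nat -> R) : Prop := WeightSequence {
  weight_gt0 : forall n, 0 < M n;
  weight0 : M 0%N = 1;
  weight_bin : forall m n, 'C(n + m, m)%:R <= M (n + m)%N / (M n * M m) }.

(* [a, b] as a type with the topology induced by R. *)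
Notation segment a b := (set_type `[a, b]%classic).

Section derivative_on_segment.
Context (R : realType) (a b : R).
Implicit Types (f g : segment a b -> R[i]) (x : segment a b).

Definition diff_quot f x (y : segment a b) : R[i] :=
  (f y - f x) / (val y - val x)%:C.

(* Here y ranges over the points of [a, b] other than x, so this is the
   one-sided notion when x is an endpoint. *)
Definition derivable_on f x := cvg (diff_quot f x y @[y --> x^']).

Definition deriv_on f x : R[i] := lim (diff_quot f x y @[y --> x^']).

Definition derivn_on n f : segment a b -> R[i] := iter n deriv_on f.

Definition smooth_on f := forall n x, derivable_on (derivn_on n f) x.

Definition sup_norm f : \bar R :=
  ereal_sup [set (Normc.normc (f x))%:E | x in [set: segment a b]].

Definition D_enorm (M : nat -> R) f : \bar R :=
  (\sum_(0 <= n <oo) (M n)^-1%:E * sup_norm (derivn_on n f))%E.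

Definition in_D (M : nat -> R) f := smooth_on f /\ (D_enorm M f < +oo)%E.

End derivative_on_segment.

Section D_norm.
Context (R : realType) (a b : R) (hab : a < b).
Context (M : nat -> R) (hM : weight_sequence M).
Implicit Types (f g : segment a b -> R[i]) (x : segment a b) (c : R[i]).

Lemma dnbhs_segment_proper x : ProperFilter (x^').
Proof.
apply: Build_ProperFilter_ex => A; rewrite /dnbhs/= /within/=.
case=> [_ [[B oB <-] /= Bx BA]].
have [/= e e0 xeB] : nbhs_ball (val x) B.
  by apply/nbhs_ballP; exact: open_nbhs_nbhs.
have /andP[ax xb] : a <= val x <= b by have := set_valP x; rewrite /= in_itv.
suff [y [yab yx xey]] : exists y : R, [/\ y \in `[a, b], y != val x & ball (val x) e y].
  have yS : y \in (`[a, b]%classic : set R) by rewrite inE.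
  exists (SigSub yS); apply: BA; first exact: xeB.
  by apply/eqP => /(congr1 val)/= /eqP; exact/negP.
have [h [h0 he hb]] : exists h : R, [/\ 0 < h, h < e & h <= (b - a) / 2].
  exists (Num.min (e / 2) ((b - a) / 2)); split.
  - by rewrite lt_min !divr_gt0// subr_gt0.
  - by rewrite gt_min; apply/orP; left; lra.
  - by rewrite ge_min lexx orbT.
move: (val x) ax xb => t ax xb .
have [xm|mx] := leP t ((a + b) / 2).
  exists (t + h); split.
  - by rewrite in_itv/=; apply/andP; split; [rewrite (le_trans ax)// lerDl ltW|lra].
  - by rewrite -subr_eq0 addrAC subrr add0r gt_eqF.
  - by rewrite /ball/= opprD addrA subrr add0r normrN gtr0_norm.
exists (t - h); split.
- by rewrite in_itv/=; apply/andP; split; lra.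
- by rewrite -subr_eq0 addrAC subrr add0r oppr_eq0 gt_eqF.
- by rewrite /ball/= opprB addrCA subrr addr0 gtr0_norm.
Qed.

Lemma deriv_on_linear c f g x : derivable_on f x -> derivable_on g x ->
  diff_quot (c *: f + g) x y @[y --> x^'] --> c * deriv_on f x + deriv_on g x.
Proof.
move=> df dg; have -> : diff_quot (c *: f + g) x =
    (fun y => c * diff_quot f x y + diff_quot g x y).
  apply/funext => y; rewrite /diff_quot.
  rewrite -[(c *: f + g) y]/(c * f y + g y) -[(c *: f + g) x]/(c * f x + g x).
  by rewrite opprD addrACA -mulrBr mulrDl mulrA.
have := dnbhs_segment_proper x => ?.
have df' : diff_quot f x y @[y --> x^'] --> deriv_on f x by exact: df.
have dg' : diff_quot g x y @[y --> x^'] --> deriv_on g x by exact: dg.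
have h1 : c * diff_quot f x y @[y --> x^'] --> c * deriv_on f x.
  exact: (cvgM (cvg_cst c) df').
exact: (cvgD h1 dg').
Qed.

Lemma derivable_on_linear c f g x : derivable_on f x -> derivable_on g x ->
  derivable_on (c *: f + g) x.
Proof.
by move=> df dg; apply/cvg_ex; eexists; exact: deriv_on_linear.
Qed.

Lemma derivn_on_linear c f g n : smooth_on f -> smooth_on g ->
  derivn_on n (c *: f + g) = c *: derivn_on n f + derivn_on n g.
Proof.
move=> sf sg; elim: n => [//|n IHn]; rewrite /derivn_on !iterS -!/(derivn_on _ _).
apply/funext => x; rewrite IHn.
have := dnbhs_segment_proper x => ?.
by apply: cvg_lim => //; exact: deriv_on_linear.
Qed.

Lemma smooth_on_linear c f g : smooth_on f -> smooth_on g ->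
  smooth_on (c *: f + g).
Proof.
by move=> sf sg n x; rewrite derivn_on_linear//; exact: derivable_on_linear.
Qed.

Lemma derivn_on0 n : derivn_on n (0 : segment a b -> R[i]) = 0.
Proof.
elim: n => [//|n IHn]; rewrite /derivn_on iterS -/(derivn_on _ _) IHn.
apply/funext => x; have := dnbhs_segment_proper x => ?.
apply: cvg_lim => //.
have -> : diff_quot 0 x = cst 0.
  by apply/funext => y; rewrite /diff_quot subrr mul0r.
exact: cvg_cst.
Qed.

Lemma smooth_on0 : smooth_on (0 : segment a b -> R[i]).
Proof.
move=> n x; rewrite derivn_on0; apply/cvg_ex; exists 0.
have -> : diff_quot 0 x = cst 0.
  by apply/funext => y; rewrite /diff_quot subrr mul0r.
exact: cvg_cst.
Qed.

Lemma left_endpoint : a \in (`[a, b]%classic : set R).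
Proof. by rewrite inE/= in_itv/= lexx ltW. Qed.

Local Open Scope ereal_scope.

Lemma normc_le_sup f x : (Normc.normc (f x))%:E <= sup_norm f.
Proof. by apply: ereal_sup_ubound; exists x. Qed.

Lemma sup_norm_ge0 f : 0 <= sup_norm f.
Proof.
apply: le_trans (normc_le_sup f (SigSub left_endpoint)).
by rewrite lee_fin; case: (f _) => ? ?; exact: sqrtr_ge0.
Qed.

Lemma sup_normD f g : sup_norm (f + g)%R <= sup_norm f + sup_norm g.
Proof.
apply: ge_ereal_sup => _ [x _ <-].
apply: (le_trans _ (leeD (normc_le_sup f x) (normc_le_sup g x))).
by rewrite -EFinD lee_fin; exact: le_normcD.
Qed.

Lemma sup_normZ c f : sup_norm (c *: f)%R = (Normc.normc c)%:E * sup_norm f.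
Proof.
rewrite /sup_norm -ereal_supZl; last 2 first.
- apply/set0P; exists (Normc.normc (f (SigSub left_endpoint)))%:E.
  by exists (SigSub left_endpoint).
- by case: c => ? ?; exact: sqrtr_ge0.
rewrite image_comp; congr ereal_sup; apply: eq_imagel => x _ /=.
by rewrite -EFinM -Normc.normcM.
Qed.

Lemma D_enorm_term_ge0 f n : 0 <= (M n)^-1%:E * sup_norm (derivn_on n f).
Proof.
by rewrite mule_ge0 ?sup_norm_ge0// lee_fin invr_ge0 ltW// weight_gt0.
Qed.

Lemma D_enorm_ge0 f : 0 <= D_enorm M f.
Proof. by apply: nneseries_ge0 => n _ _; exact: D_enorm_term_ge0. Qed.

Lemma D_enormD f g : smooth_on f -> smooth_on g ->
  D_enorm M (f + g)%R <= D_enorm M f + D_enorm M g.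
Proof.
move=> sf sg; rewrite /D_enorm -nneseriesD; last 2 first.
- by move=> *; exact: D_enorm_term_ge0.
- by move=> *; exact: D_enorm_term_ge0.
apply: lee_nneseries => n _; first by move=> *; exact: D_enorm_term_ge0.
rewrite -ge0_muleDr ?sup_norm_ge0// lee_pmul2l//; last first.
  by rewrite lte_fin invr_gt0 weight_gt0.
have -> : derivn_on n (f + g)%R = (derivn_on n f + derivn_on n g)%R.
  by rewrite -[f]scale1r derivn_on_linear// !scale1r.
exact: sup_normD.
Qed.

Lemma D_enormZ c f : smooth_on f ->
  D_enorm M (c *: f)%R = (Normc.normc c)%:E * D_enorm M f.
Proof.
move=> sf; rewrite /D_enorm -nneseriesZl; last first.
  by move=> *; exact: D_enorm_term_ge0.
apply: eq_eseriesr => n _.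
have -> : derivn_on n (c *: f)%R = (c *: derivn_on n f)%R.
  have := derivn_on_linear c n sf smooth_on0.
  by rewrite derivn_on0 (addr0 (c *: f)%R) addr0.
by rewrite sup_normZ muleCA.
Qed.

Lemma normc_le_D_enorm f x : (Normc.normc (f x))%:E <= D_enorm M f.
Proof.
rewrite /D_enorm nneseries_recl//; last by move=> *; exact: D_enorm_term_ge0.
rewrite weight0// invr1 mul1e (le_trans (normc_le_sup f x))// leeDl//.
by rewrite nneseries_ge0// => *; exact: D_enorm_term_ge0.
Qed.

Lemma D_enorm0 : D_enorm M (0 : segment a b -> R[i])%R = 0.
Proof.
rewrite -[X in D_enorm M X](scale0r (0 : segment a b -> R[i])%R) D_enormZ.
  by rewrite Normc.normc0 mul0e.
exact: smooth_on0.
Qed.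

Local Close Scope ereal_scope.

End D_norm.

(* The unused hypotheses let the normed space structure below, whose axioms
   depend on them, be inferred from the type. *)
Definition DX_pred (R : realType) (a b : R) (hab : a < b)
    (M : nat -> R) (hM : weight_sequence M) : {pred segment a b -> R[i]} :=
  mem [set f | in_D M f].

Section D_space.
Context (R : realType) (a b : R) (hab : a < b).
Context (M : nat -> R) (hM : weight_sequence M).
Implicit Types (c : R[i]).

Lemma DX_submod_closed : submod_closed (DX_pred hab hM).
Proof.
split=> [|c f g].
  by rewrite inE; split; [exact: smooth_on0 hab|rewrite (D_enorm0 hab hM)].
rewrite !inE => -[sf ff] [sg fg]; split; first exact: (smooth_on_linear hab).
have scf : smooth_on (c *: f).
  by have := smooth_on_linear (c := c) hab sf (smooth_on0 hab); rewrite (addr0 (c *: f)).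
apply: (le_lt_trans (D_enormD hab hM scf sg)).
rewrite lte_add_pinfty// (D_enormZ hab hM)// lte_mul_pinfty// lee_fin.
by case: (c) => ? ?; exact: sqrtr_ge0.
Qed.

HB.instance Definition _ := GRing.isSubmodClosed.Build R[i] (segment a b -> R[i])
  (DX_pred hab hM) DX_submod_closed.

(* D([a, b], M), a normed space for the norm |f| = D_enorm M f. *)
Record DX := MkDX { DX_val :> segment a b -> R[i]; _ : DX_val \in DX_pred hab hM }.

HB.instance Definition _ := [isSub for DX_val].
HB.instance Definition _ := [Choice of DX by <:].
HB.instance Definition _ := [SubChoice_isSubLmodule of DX by <:].

Lemma DXP (u : DX) : in_D M u.
Proof. by case: u => f /=; rewrite inE. Qed.

Definition DX_norm (u : DX) : R[i] := (fine (D_enorm M u))%:C.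

Lemma DX_enorm_fin (u : DX) : D_enorm M u \is a fin_num.
Proof. by rewrite ge0_fin_numE ?(D_enorm_ge0 hab hM)//; have [] := DXP u. Qed.

Lemma DX_valD (u v : DX) : DX_val (u + v) = DX_val u + DX_val v.
Proof. by []. Qed.

Lemma DX_valZ c (u : DX) : DX_val (c *: u) = c *: DX_val u.
Proof. by []. Qed.

Lemma DX_normD u v : DX_norm (u + v) <= DX_norm u + DX_norm v.
Proof.
rewrite /DX_norm -rmorphD lecR -fineD ?DX_enorm_fin// fine_le ?DX_enorm_fin//.
  by rewrite fin_numD !DX_enorm_fin.
have [su _] := DXP u; have [sv _] := DXP v.
by rewrite DX_valD; exact: (D_enormD hab hM su sv).
Qed.

Lemma DX_normZ c u : DX_norm (c *: u) = `|c| * DX_norm u.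
Proof.
have [su _] := DXP u.
rewrite /DX_norm -[`|c|]/((Normc.normc c)%:C) -rmorphM.
by rewrite DX_valZ (D_enormZ hab hM c su) fineM// DX_enorm_fin.
Qed.

Lemma DX_norm0_eq0 u : DX_norm u = 0 -> u = 0.
Proof.
rewrite /DX_norm => /complexI u0; apply/val_inj/funext => x.
apply: Normc.eq0_normc; apply/eqP; rewrite eq_le; apply/andP; split.
  by rewrite -lee_fin (le_trans (normc_le_D_enorm hab hM u x))// -(fineK (DX_enorm_fin u)) u0.
by case: (val u x) => ? ?; exact: sqrtr_ge0.
Qed.

HB.instance Definition _ := Lmodule_isNormed.Build R[i] DX
  DX_normD DX_normZ DX_norm0_eq0.

Definition induces_endomorphism (phi : segment a b -> segment a b) :=
  forall f, in_D M f -> in_D M (f \o phi).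

Section composition.
Context (phi : segment a b -> segment a b) (hphi : induces_endomorphism phi).

Lemma comp_endo_subproof (u : DX) : (u : segment a b -> R[i]) \o phi \in DX_pred hab hM.
Proof. by rewrite inE; exact: hphi (DXP u). Qed.

Definition comp_endo (u : DX) : DX := MkDX (comp_endo_subproof u).

Lemma comp_endo_linear : linear comp_endo.
Proof. by move=> c u v; apply/val_inj/funext. Qed.

HB.instance Definition _ := GRing.isLinear.Build R[i] DX DX *:%R comp_endo
  comp_endo_linear.

End composition.

End D_space.

Arguments comp_endo {R a b} hab {M} hM {phi} hphi u.

Definition compact_operator (K : numFieldType) (U V : normedModType K)
    (T : {linear U -> V}) :=
  forall B : set U, bounded_set B -> precompact (T @` B).

Definition induces_compact_endomorphism (R : realType) (a b : R) (hab : a < b)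
    (M : nat -> R) (hM : weight_sequence M)
    (phi : segment a b -> segment a b) :=
  exists hphi : induces_endomorphism M phi,
    compact_operator (comp_endo hab hM hphi : {linear DX hab hM -> DX hab hM}).

(* Main.v *)
(** Let [lambda = phi'(x0)] and let [V_k] be the space of [f] in [D(X, M)] whose
    derivatives of order less than [k] vanish at [x0].  Since [x0] is fixed,
    [T f = f \o phi] maps [V_k] to itself and multiplies the functional
    [f |-> f^(k)(x0)] on [V_k], which is bounded and nonzero, by [lambda ^+ k].
    As in Riesz's lemma, choose [f_k] in the unit ball of [V_k] nearly
    attaining the norm of this functional.  For [m < n] the functional of order
    [m] vanishes at [T f_n], so
    [|T f_m - T f_n| >= |lambda| ^+ m / 2], and [|lambda| >= 1] would make
    [(T f_n)_n] a separated sequence, contradicting the compactness of [T]. *)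

Require Import Defs.
From mathcomp Require Import all_boot all_order all_algebra.
From mathcomp Require Import all_classical all_reals all_analysis.
From mathcomp Require Import complex ring lra.

Import Order.TTheory GRing.Theory Num.Theory.
Import numFieldNormedType.Exports.

Local Open Scope classical_set_scope.
Local Open Scope ring_scope.
Local Open Scope complex_scope.

Set Implicit Arguments.
Unset Strict Implicit.
Unset Printing Implicit Defensive.

(** * Differentiation on a segment: product and chain rules *)

Section calculus.
Context (R : realType) (a b : R) (hab : a < b).
Implicit Types (f g : segment a b -> R[i]) (x y : segment a b) (l : R[i]).

Definition valC x : R[i] := (val x)%:C.

#[local] Instance nbhs_segment_filter x : Filter (nbhs x).
Proof. exact: nbhs_filter. Qed.

(** A relation instead of a value of [lim]: it carries existence and value of the derivative
    together. *)
Definition is_deriv_on f x l := diff_quot f x y @[y --> x^'] --> l.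

Lemma is_deriv_on_eq f x l : is_deriv_on f x l -> deriv_on f x = l.
Proof.
have := dnbhs_segment_proper hab x => ? fl; exact: cvg_lim.
Qed.

Lemma is_deriv_on_derivable f x l : is_deriv_on f x l -> derivable_on f x.
Proof. by move=> fl; apply/cvg_ex; exists l. Qed.

Lemma valCB_neq0 x y : y != x -> valC y - valC x != 0.
Proof.
move=> yx; rewrite subr_eq0; apply: contra yx => /eqP/complexI yx.
by apply/eqP/val_inj.
Qed.

(* Caratheodory's form of differentiability, which makes the product and chain
   rules purely algebraic. *)
Lemma is_deriv_onP f x l : is_deriv_on f x l <->
  exists q : segment a b -> R[i], [/\ forall y, f y - f x = q y * (valC y - valC x),
    q x = l & q y @[y --> x] --> l].
Proof.
split=> [fl|[q [fq qx ql]]].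
  (* The difference quotient, completed by [l] at [x], where division by 0 would give it the value
     0. *)
  exists (fun y => if y == x then l else diff_quot f x y); split.
  - move=> y; case: eqVneq => [->|yx]; first by rewrite !subrr mulr0.
    by rewrite /diff_quot rmorphB divfK// valCB_neq0.
  - by rewrite eqxx.
  - move=> A lA.
    have fA : \forall y \near x, y != x -> A (diff_quot f x y) by exact: fl lA.
    apply: filterS fA => y /=.
    by case: eqVneq => [_ _|yx]; [exact: nbhs_singleton lA|exact].
move=> A lA; have qA : \forall y \near x, A (q y) by exact: ql lA.
suff : \forall y \near x, y != x -> A (diff_quot f x y) by [].
apply: filterS qA => y /= Ay yx.
by rewrite /diff_quot rmorphB fq mulfK// valCB_neq0.
Qed.

Lemma normc_real (r : R) : `|r%:C| = `|r|%:C :> R[i].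
Proof. by rewrite normc_def /= expr0n addr0 sqrtr_sqr. Qed.

Lemma valC_cvg x : valC y @[y --> x] --> valC x.
Proof.
apply/(@cvgrPdist_lt _ _ _ (nbhs x)) => e e0.
(* A positive element of [R[i]] is real, so [e] may be replaced by its real part. *)
move: (e0); rewrite -(RRe_real (gtr0_real e0)) ltcR; move: (complex.Re e) => r r0.
have vc : continuous (val : segment a b -> R) by exact: initial_continuous.
have : \forall y \near x, ball (val x) r (val y) by apply: vc; exact: nbhsx_ballx.
by apply: filterS => y; rewrite -rmorphB normc_real ltcR.
Qed.

Lemma is_deriv_on_cvg f x l : is_deriv_on f x l -> f y @[y --> x] --> f x.
Proof.
move=> /is_deriv_onP[q [fq qx]]; rewrite -qx => ql.
have -> : f = (fun y => f x + q y * (valC y - valC x)).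
  by apply/funext => y; rewrite -fq addrCA subrr addr0.
rewrite subrr mulr0 -[X in _ --> _ + X](mulr0 (q x)) -(subrr (valC x)).
have dc : valC y - valC x @[y --> x] --> valC x - valC x.
  exact: (cvgB (@valC_cvg x) (cvg_cst _)).
have qdc : q y * (valC y - valC x) @[y --> x] --> q x * (valC x - valC x).
  exact: (cvgM ql dc).
exact: (cvgD (cvg_cst _) qdc).
Qed.

Lemma is_deriv_on_cst c x : is_deriv_on (fun=> c) x 0.
Proof.
apply/is_deriv_onP; exists (fun=> 0); split=> //.
- by move=> y; rewrite subrr mul0r.
- exact: cvg_cst.
Qed.

Lemma is_deriv_on_valC x : is_deriv_on valC x 1.
Proof.
apply/is_deriv_onP; exists (fun=> 1); split=> //.
- by move=> y; rewrite mul1r.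
- exact: cvg_cst.
Qed.

Lemma is_deriv_onD f g x l l' : is_deriv_on f x l -> is_deriv_on g x l' ->
  is_deriv_on (f \+ g) x (l + l').
Proof.
move=> /is_deriv_onP[p [fp px pl]] /is_deriv_onP[q [gq qx ql]].
apply/is_deriv_onP; exists (p \+ q); split.
- by move=> y /=; rewrite mulrDl -fp -gq opprD addrACA.
- by rewrite /= px qx.
- exact: (cvgD pl ql).
Qed.

Lemma is_deriv_onM f g x l l' : is_deriv_on f x l -> is_deriv_on g x l' ->
  is_deriv_on (f \* g) x (l * g x + f x * l').
Proof.
move=> fl gl; have fc := is_deriv_on_cvg fl; have gc := is_deriv_on_cvg gl.
move: fl gl => /is_deriv_onP[p [fp px pl]] /is_deriv_onP[q [gq qx ql]].
apply/is_deriv_onP; exists (fun y => p y * g x + f y * q y); split.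
- move=> y /=; rewrite mulrDl mulrAC -fp -mulrA -gq; ring.
- by rewrite px qx.
- have pg : p y * g x @[y --> x] --> l * g x by exact: (cvgM pl (cvg_cst _)).
  have fq : f y * q y @[y --> x] --> f x * l' by exact: (cvgM fc ql).
  exact: (cvgD pg fq).
Qed.

(** Continuity into the segment follows from that of the complex coordinate, since the embedding of
    the reals in [R[i]] is isometric. *)
Lemma is_deriv_on_segment_cvg (phi : segment a b -> segment a b) x l :
  is_deriv_on (valC \o phi) x l -> phi y @[y --> x] --> phi x.
Proof.
move=> /is_deriv_on_cvg /cvgrPdist_lt pc; apply/cvg_ballP => e e0.
have e0' : 0 < e%:C by rewrite ltcR.
have := pc _ e0'; apply: filterS => y.
by rewrite /= -rmorphB normc_real ltcR.
Qed.

Lemma is_deriv_on_comp f (phi : segment a b -> segment a b) x l l' :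
  is_deriv_on (valC \o phi) x l' -> is_deriv_on f (phi x) l ->
  is_deriv_on (f \o phi) x (l * l').
Proof.
move=> phil; have phic := is_deriv_on_segment_cvg phil.
move: phil => /is_deriv_onP[p [php px pl]] /is_deriv_onP[q [fq qx ql]].
apply/is_deriv_onP; exists (fun y => q (phi y) * p y); split.
- by move=> y; rewrite -mulrA -php; exact: fq.
- by rewrite px qx.
- have qphi : q (phi y) @[y --> x] --> l by exact: cvg_comp phic ql.
  exact: (cvgM qphi pl).
Qed.

(** Differentiability [n] times. A finite order lets the inductions below pass from [f] to its
    derivative at the cost of one order. *)
Definition derivable_upto n f := forall j, (j < n)%N -> forall x, derivable_on (derivn_on j f) x.

Lemma derivn_onSr n f : derivn_on n.+1 f = derivn_on n (deriv_on f).
Proof. exact: iterSr. Qed.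

Lemma derivable_upto_le m n f : (m <= n)%N -> derivable_upto n f -> derivable_upto m f.
Proof. by move=> mn df j jm; apply: df; exact: leq_trans mn. Qed.

Lemma derivable_upto_deriv n f : derivable_upto n.+1 f -> derivable_upto n (deriv_on f).
Proof. by move=> df j jn x; rewrite -derivn_onSr; exact: df. Qed.

Lemma derivable_upto_is_deriv_on n f x : derivable_upto n.+1 f -> is_deriv_on f x (deriv_on f x).
Proof. by move=> df; exact: (df 0%N). Qed.

Lemma is_deriv_on_fun f f' : (forall x, is_deriv_on f x (f' x)) -> deriv_on f = f'.
Proof. by move=> ff'; apply/funext => x; exact: is_deriv_on_eq. Qed.

Lemma derivable_uptoS n f f' : (forall x, is_deriv_on f x (f' x)) ->
  derivable_upto n f' -> derivable_upto n.+1 f.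
Proof.
move=> ff' df' [_ x|j]; first exact: is_deriv_on_derivable (ff' x).
by rewrite ltnS => jn x; rewrite derivn_onSr (is_deriv_on_fun ff'); exact: df'.
Qed.

Lemma derivn_onD n f g : derivable_upto n f -> derivable_upto n g ->
  derivable_upto n (f \+ g) /\ derivn_on n (f \+ g) = derivn_on n f \+ derivn_on n g.
Proof.
elim: n f g => [|n IHn] f g df dg; first by split; [move=> j; rewrite ltn0|].
have fg x : is_deriv_on (f \+ g) x ((deriv_on f \+ deriv_on g) x).
  exact: (is_deriv_onD (derivable_upto_is_deriv_on df) (derivable_upto_is_deriv_on dg)).
have [d e] := IHn _ _ (derivable_upto_deriv df) (derivable_upto_deriv dg).
by split; [exact: derivable_uptoS fg d|rewrite !derivn_onSr (is_deriv_on_fun fg)].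
Qed.

Lemma deriv_onM n f g : derivable_upto n.+1 f -> derivable_upto n.+1 g ->
  forall x, is_deriv_on (f \* g) x (((deriv_on f \* g) \+ (f \* deriv_on g)) x).
Proof.
move=> df dg x.
exact: (is_deriv_onM (derivable_upto_is_deriv_on df) (derivable_upto_is_deriv_on dg)).
Qed.

Lemma derivable_uptoM n f g : derivable_upto n f -> derivable_upto n g ->
  derivable_upto n (f \* g).
Proof.
elim: n f g => [|n IHn] f g df dg; first by move=> j; rewrite ltn0.
apply: derivable_uptoS (deriv_onM df dg) _.
by apply: (derivn_onD _ _).1; apply: IHn => //;
  [exact: derivable_upto_deriv|exact: derivable_upto_le dg
  |exact: derivable_upto_le df|exact: derivable_upto_deriv].
Qed.

(** * Higher derivatives of a composition at a fixed point *)

Section composition.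
Variable phi : segment a b -> segment a b.
Local Notation phi' := (deriv_on (valC \o phi)).

Lemma deriv_on_comp n f : derivable_upto n.+1 (valC \o phi) -> derivable_upto n.+1 f ->
  forall x, is_deriv_on (f \o phi) x (((deriv_on f \o phi) \* phi') x).
Proof.
move=> dphi df x.
exact: (is_deriv_on_comp (derivable_upto_is_deriv_on dphi) (derivable_upto_is_deriv_on df)).
Qed.

Lemma derivable_upto_comp n f : derivable_upto n (valC \o phi) -> derivable_upto n f ->
  derivable_upto n (f \o phi).
Proof.
elim: n f => [|n IHn] f dphi df; first by move=> j; rewrite ltn0.
apply: derivable_uptoS (deriv_on_comp dphi df) _.
apply: derivable_uptoM; last exact: derivable_upto_deriv.
by apply: IHn; [exact: derivable_upto_le dphi|exact: derivable_upto_deriv].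
Qed.

(* The factor g makes the induction on k go through, since
   ((f \o phi) g)' = (f' \o phi) (phi' g) + (f \o phi) g'. *)
Lemma derivn_on_compM k f g x0 : phi x0 = x0 ->
  derivable_upto k (valC \o phi) -> derivable_upto k f -> derivable_upto k g ->
  (forall j, (j < k)%N -> derivn_on j f x0 = 0) ->
  derivn_on k ((f \o phi) \* g) x0 = phi' x0 ^+ k * derivn_on k f x0 * g x0.
Proof.
move=> x0E; elim: k f g => [|k IHk] f g dphi df dg f0.
  by rewrite expr0 mul1r /= x0E.
have dphik := derivable_upto_le (leqnSn k) dphi.
have dfk := derivable_upto_le (leqnSn k) df.
have dgk := derivable_upto_le (leqnSn k) dg.
have df' := derivable_upto_deriv df.
have dg' := derivable_upto_deriv dg.
have dphi' := derivable_upto_deriv dphi.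
have dphig := derivable_uptoM dphi' dgk.
(* Both terms have the shape treated by the induction hypothesis: [f'] with the factor [phi' g], and
   [f] with the factor [g']. *)
have D x : is_deriv_on ((f \o phi) \* g) x
    ((((deriv_on f \o phi) \* (phi' \* g)) \+ ((f \o phi) \* deriv_on g)) x).
  have := @deriv_onM k _ _ (derivable_upto_comp dphi df) dg x.
  by rewrite (is_deriv_on_fun (deriv_on_comp dphi df)) /= mulrA.
rewrite derivn_onSr (is_deriv_on_fun D) (derivn_onD _ _).2; last 2 first.
- exact: derivable_uptoM (derivable_upto_comp dphik df') dphig.
- exact: derivable_uptoM (derivable_upto_comp dphik dfk) dg'.
have f0k j : (j < k)%N -> derivn_on j f x0 = 0 by move=> jk; apply: f0; exact: ltnW.
have f'0 j : (j < k)%N -> derivn_on j (deriv_on f) x0 = 0.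
  by move=> jk; rewrite -derivn_onSr; exact: f0.
(* The second term contains the derivative of [f] of order [k] at [x0], which vanishes; the first
   provides the extra factor [phi' x0]. *)
rewrite /= (IHk _ _ dphik df' dphig f'0) (IHk _ _ dphik dfk dg' f0k) (f0 k (leqnn _)).
by rewrite mulr0 mul0r addr0 -derivn_onSr exprSr /=; ring.
Qed.

Lemma derivn_on_comp k f x0 : phi x0 = x0 ->
  derivable_upto k (valC \o phi) -> derivable_upto k f ->
  (forall j, (j < k)%N -> derivn_on j f x0 = 0) ->
  derivn_on k (f \o phi) x0 = phi' x0 ^+ k * derivn_on k f x0.
Proof.
move=> x0E dphi df f0.
have d1 n c : derivable_upto n (fun=> c).
  elim: n c => [|n IHn] c; first by move=> j; rewrite ltn0.
  apply: derivable_uptoS (IHn 0) => x.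
  exact: is_deriv_on_cst.
have := derivn_on_compM x0E dphi df (d1 k 1) f0.
by rewrite mulr1 => <-; congr (derivn_on k _ x0); apply/funext => y /=; rewrite mulr1.
Qed.

End composition.

(** * Polynomials in the algebra, and bounds on derivatives by the norm *)

Lemma is_deriv_on_horner (p : {poly R[i]}) x :
  is_deriv_on (fun y => p.[valC y]) x p^`().[valC x].
Proof.
elim/poly_ind: p => [|p c IHp].
  rewrite deriv0 horner0.
  have -> : (fun y => (0 : {poly R[i]}).[valC y]) = fun=> 0.
    by apply/funext => y; rewrite horner0.
  exact: is_deriv_on_cst.
have -> : (fun y => (p * 'X + c%:P).[valC y]) =
    ((fun y => p.[valC y]) \* valC) \+ (fun=> c).
  by apply/funext => y; rewrite !hornerE.
have := is_deriv_onD (is_deriv_onM IHp (is_deriv_on_valC x)) (is_deriv_on_cst c x).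
by rewrite addr0 mulr1 derivMXaddC !hornerE [in p.[valC x] + _]addrC.
Qed.

Lemma derivn_on_horner n (p : {poly R[i]}) :
  derivn_on n (fun x => p.[valC x]) = fun x => p^`(n).[valC x].
Proof.
elim: n p => [|n IHn] p; first by [].
by rewrite derivn_onSr (is_deriv_on_fun (@is_deriv_on_horner p)) IHn derivSn.
Qed.

Lemma smooth_on_horner (p : {poly R[i]}) : smooth_on (fun x => p.[valC x]).
Proof.
move=> n x; rewrite derivn_on_horner.
exact: is_deriv_on_derivable (@is_deriv_on_horner _ x).
Qed.

Lemma norm_valC_le x : `|valC x| <= (`|a| + `|b|)%:C.
Proof.
rewrite normc_real lecR; have /andP[ax xb] : a <= val x <= b.
  by have := set_valP x; rewrite /= in_itv.
have := ler_norm b; have := ler_norm (- a); rewrite normrN.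
have := normr_ge0 a; have := normr_ge0 b.
by rewrite ler_norml; move=> ? ? ? ?; apply/andP; split; lra.
Qed.

Lemma sup_norm_horner_lty (p : {poly R[i]}) :
  (sup_norm (fun x => p.[valC x]) < +oo)%E.
Proof.
suff [B pB] : exists B : R, forall x, `|p.[valC x]| <= B%:C.
  apply: (@le_lt_trans _ _ B%:E); last exact: ltry.
  by apply: ge_ereal_sup => _ [x _ <-]; rewrite lee_fin -lecR; exact: (pB x).
(* The bound follows Horner's scheme, with [|a| + |b|] bounding the variable. *)
elim/poly_ind: p => [|p c [B pB]].
  by exists 0 => x; rewrite horner0 normr0.
exists (B * (`|a| + `|b|) + Normc.normc c) => x; rewrite !hornerE.
apply: (le_trans (ler_normD _ _)); rewrite rmorphD rmorphM; apply: lerD; last exact: lexx.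
by rewrite normrM; apply: ler_pM; rewrite ?normr_ge0 ?norm_valC_le ?pB.
Qed.

Section weights.
Variables (M : nat -> R) (hM : weight_sequence M).

(** Derivatives of order at least [size p] vanish, so the norm is a finite sum of finite terms. *)
Lemma in_D_horner (p : {poly R[i]}) : in_D M (fun x => p.[valC x]).
Proof.
split; first exact: smooth_on_horner.
rewrite /D_enorm (nneseries_split _ (size p)); last first.
  by move=> k _; exact: D_enorm_term_ge0.
rewrite add0n [X in (_ + X)%E]eseries0 ?adde0.
  apply/lte_sum_pinfty => n _; rewrite lte_mul_pinfty//.
  - by rewrite lee_fin invr_ge0 ltW// weight_gt0.
  - by rewrite derivn_on_horner sup_norm_horner_lty.
move=> n pn _; rewrite derivn_on_horner derivn_poly0//.
suff -> : sup_norm (fun x => (0 : {poly R[i]}).[valC x]) = 0%E by rewrite mule0.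
apply/eqP; rewrite eq_le sup_norm_ge0// andbT.
by apply: ge_ereal_sup => _ [x _ <-]; rewrite horner0 Normc.normc0.
Qed.

(** The norm dominates each single term of its series. Hence taking the derivative of order [n] at
    [x] is a bounded functional. *)
Lemma normc_derivn_on_le n f x : in_D M f ->
  Normc.normc (derivn_on n f x) <= M n * fine (D_enorm M f).
Proof.
move=> [sf ff]; have fin : D_enorm M f \is a fin_num.
  by rewrite ge0_fin_numE ?(D_enorm_ge0 hab hM).
rewrite -ler_pdivrMl ?weight_gt0// -lee_fin fineK// EFinM.
apply: (@le_trans _ _ ((M n)^-1%:E * sup_norm (derivn_on n f))%E).
  by apply: lee_wpmul2l; [rewrite lee_fin invr_ge0 ltW// weight_gt0|exact: normc_le_sup].
have := @nneseries_lim_ge R (fun n => (M n)^-1%:E * sup_norm (derivn_on n f))%E predT 0 n.+1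
  (fun n _ _ => D_enorm_term_ge0 hab hM f n).
apply: le_trans; rewrite big_nat_recr//= leeDr// sume_ge0// => m _.
exact: D_enorm_term_ge0.
Qed.

End weights.

End calculus.

(** * Near-extremal functions among those vanishing to a given order *)

Section vanishing_jets.
Context (R : realType) (a b : R) (hab : a < b).
Context (M : nat -> R) (hM : weight_sequence M).
Local Notation DX := (DX hab hM).
Implicit Types (u v : DX) (x : segment a b) (c : R[i]).

Lemma derivn_on_DX k c u v x : derivn_on k (c *: u + v : DX) x =
  c * derivn_on k u x + derivn_on k v x.
Proof.
have [su _] := DXP u; have [sv _] := DXP v.
by rewrite DX_valD DX_valZ (derivn_on_linear hab c k su sv).
Qed.

Lemma derivn_on_DXZ k c u x : derivn_on k (c *: u : DX) x = c * derivn_on k u x.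
Proof.
have -> : c *: u = c *: u + 0 by rewrite addr0.
by rewrite derivn_on_DX (derivn_on0 hab) addr0.
Qed.

Lemma norm_derivn_on_le k u x : `|derivn_on k u x| <= (M k)%:C * `|u|.
Proof.
rewrite -[`|u|]/(DX_norm u) -rmorphM.
rewrite -[`|derivn_on k u x|]/((Normc.normc (derivn_on k u x))%:C) lecR.
exact: (normc_derivn_on_le hab hM k x (DXP u)).
Qed.

(** The space [V_k] at the point [x]; the order [k] itself is left free. *)
Definition vanishes_upto k x u := forall j, (j < k)%N -> derivn_on j u x = 0.

Lemma vanishes_uptoZ k x c u : vanishes_upto k x u -> vanishes_upto k x (c *: u).
Proof. by move=> u0 j jk; rewrite derivn_on_DXZ (u0 j jk) mulr0. Qed.

(** The functional of order [k] is nonzero on [V_k]: the witness is the polynomial [(X - x)^k],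
    whose derivative of order [k] is [k!]. *)
Lemma exists_vanishes_upto k x : exists u, vanishes_upto k x u /\ derivn_on k u x != 0.
Proof.
pose p (n : nat) := ('X - (valC x)%:P) ^+ n : {poly R[i]}.
have pD : (fun y => (p k).[valC y]) \in DX_pred hab hM.
  by rewrite inE; exact: in_D_horner.
have dp n : (p n.+1)^`() = p n *+ n.+1.
  by rewrite /p deriv_exp derivXsubC mul1r.
exists (MkDX pD); split=> [j jk|]; rewrite /= derivn_on_horner//.
  elim: j (k) jk => [|j IHj] [//|n] jn.
    by rewrite derivn0 /p horner_exp hornerXsubC subrr expr0n.
  by rewrite derivSn dp derivnMn hornerMn (IHj n jn) mul0rn.
elim: (k) => [|n IHn]; first by rewrite derivn0 /p expr0 hornerE oner_eq0.
by rewrite derivSn dp derivnMn hornerMn mulrn_eq0 negb_or.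
Qed.

(** The norm is [R[i]]-valued; its real value allows comparisons in the totally ordered [R]. *)
Lemma normDX_real u : exists r : R, 0 <= r /\ `|u| = r%:C.
Proof.
exists (fine (D_enorm M u)); split; last by [].
by rewrite fine_ge0// (D_enorm_ge0 hab hM).
Qed.

(** Boundedness of the functional makes its supremum over the unit ball of [V_k] finite, and its
    being nonzero makes the supremum positive. Any [u] attaining more than half of it then works,
    whence the factor 2. *)
Lemma near_extremal k x : exists u, [/\ `|u| <= 1, vanishes_upto k x u,
  derivn_on k u x != 0 & forall v, vanishes_upto k x v ->
    `|derivn_on k v x| <= 2 * `|derivn_on k u x| * `|v| ].
Proof.
pose E := [set r : R | exists u, [/\ `|u| <= 1, vanishes_upto k x u
  & `|derivn_on k u x| = r%:C]].
(* By homogeneity, normalising [v] reduces the estimate to the unit ball. If [v] has norm 0, its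
   derivative is 0 as well and [r = 0] is taken. *)
have EZ v : vanishes_upto k x v -> exists2 r, E r & `|derivn_on k v x| = r%:C * `|v|.
  move=> v0; have [n [n0 nE]] := normDX_real v.
  have [nz|nz] := eqVneq n 0.
    exists 0; first by exists 0; split=> [|j _|]; rewrite ?normr0// (derivn_on0 hab)// normr0.
    apply/eqP; rewrite mul0r -normr_le0 normr_id.
    by rewrite (le_trans (norm_derivn_on_le k v x))// nE nz mulr0.
  have nC : n%:C != 0 :> R[i] by rewrite fmorph_eq0.
  pose w := (n%:C)^-1 *: v.
  exists (Normc.normc (derivn_on k w x)).
    exists w; split; last by [].
      rewrite normrZ nE normfV ger0_norm ?ler0c// mulVf// lexx.
    exact: vanishes_uptoZ.
  rewrite -[(Normc.normc _)%:C]/(`|derivn_on k w x|) derivn_on_DXZ normrM nE normfV.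
  by rewrite [`|n%:C|]ger0_norm ?ler0c// mulrAC mulVf// mul1r.
have Eub : ubound E (M k).
  move=> r [u [u1 _ ur]]; rewrite -lecR -ur.
  apply: (le_trans (norm_derivn_on_le k u x)).
  by rewrite -[leRHS]mulr1 ler_wpM2l// ler0c ltW// weight_gt0.
have Esup : has_sup E.
  have [u [u0 _]] := exists_vanishes_upto k x.
  by split; [have [r Er _] := EZ _ u0; exists r|exists (M k)].
have Ele r : E r -> r <= sup E by move=> Er; apply: ub_le_sup => //; exists (M k).
have sup0 : 0 < sup E.
  have [u [u0 un]] := exists_vanishes_upto k x; have [r Er ur] := EZ _ u0.
  apply: lt_le_trans (Ele _ Er).
  have [n [n0 nE]] := normDX_real u.
  have : `|derivn_on k u x| > 0 by rewrite normr_gt0.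
  rewrite ur nE -rmorphM ltcR => rn.
  by rewrite ltNge; apply/negP => r0; move: rn; rewrite ltNge mulr_le0_ge0.
have sup2 : 0 < sup E / 2 by rewrite divr_gt0.
have [r [u [u1 u0 ur]] rs] := sup_adherent sup2 Esup.
exists u; split=> //.
  rewrite -normr_gt0 ur ltcR; lra.
move=> v v0; have [s Es ->] := EZ v v0.
rewrite ler_wpM2r// ur -[2]/(2%:R) -(rmorph_nat (real_complex R)) -rmorphM lecR.
have := Ele _ Es; lra.
Qed.

End vanishing_jets.

(** * Action of the endomorphism on derivatives at a fixed point *)

Section fixed_point.
Context (R : realType) (a b : R) (hab : a < b).
Context (M : nat -> R) (hM : weight_sequence M).
Context (phi : segment a b -> segment a b) (hphi : induces_endomorphism M phi).
Local Notation DX := (DX hab hM).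
Local Notation T := (comp_endo hab hM hphi).

(** The coordinate function is the polynomial ['X], hence lies in the algebra, and so does its
    composition with [phi]. *)
Lemma derivable_upto_valC_comp k : derivable_upto k (@valC R a b \o phi).
Proof.
have [sphi _] := hphi (in_D_horner hab hM 'X).
move=> j _ x; have := sphi j x; congr (derivable_on (derivn_on j _) x).
by apply/funext => y /=; rewrite hornerX.
Qed.

Lemma derivn_on_comp_endo k (x0 : segment a b) (u : DX) : phi x0 = x0 ->
  vanishes_upto k x0 u ->
  derivn_on k (T u) x0 = deriv_on (@valC R a b \o phi) x0 ^+ k * derivn_on k u x0.
Proof.
move=> x0E u0; have [su _] := DXP u.
have du : derivable_upto k u by move=> j _ x; exact: su.
exact: (derivn_on_comp hab x0E (@derivable_upto_valC_comp k) du u0).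
Qed.

(** The formula applies at each order [j < k], because [u] vanishes to order [j] too, and its
    right-hand side contains a zero derivative of [u]. *)
Lemma comp_endo_vanishes_upto k (x0 : segment a b) (u : DX) : phi x0 = x0 ->
  vanishes_upto k x0 u -> vanishes_upto k x0 (T u).
Proof.
move=> x0E u0 j jk; rewrite derivn_on_comp_endo// ?u0 ?mulr0// => i ij.
by apply: u0; exact: ltn_trans jk.
Qed.

End fixed_point.

(** * Separated sequences and the contradiction with compactness *)

(* A cluster point of u is within 1/4 of two distinct terms of u. *)
Lemma precompact_not_separated (K : numFieldType) (V : normedModType K)
    (A : set V) (u : nat -> V) :
  precompact A -> (forall n, A (u n)) ->
  ~ (forall m n, (m < n)%N -> 2^-1 <= `|u m - u n|).
Proof.
rewrite precompactE => cA uA usep.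
have uC : (u @ \oo) (closure A).
  suff : \forall n \near \oo, closure A (u n) by [].
  by apply: nearW => n; exact/subset_closure.
have [p [_ pu]] := cA (u @ \oo) _ uC.
(* Each tail of [u] belongs to the filter, hence meets the ball of radius 1/4 about [p]; using this
   twice yields [m < n] with both terms in the ball. *)
have near_p N : exists2 n, (N < n)%N & `|p - u n| < 4^-1.
  have uN : (u @ \oo) [set u n | n in [set n | (N < n)%N]].
    by apply: filterS (nbhs_infty_gt N) => n Nn; exists n.
  have pB : nbhs p (ball p (4^-1 : K)) by apply: nbhsx_ballx; rewrite invr_gt0.
  have [_ [[n Nn <-]]] := pu _ _ uN pB.
  by rewrite -ball_normE /= => pn; exists n.
have [m _ pm] := near_p 0%N; have [n mn pn] := near_p m.
have := usep _ _ mn; apply/negP; rewrite -real_ltNge ?normr_real//.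
have -> : 2^-1 = 4^-1 + 4^-1 :> K by field.
rewrite -(subrKA p); apply: (le_lt_trans (ler_normD _ _)).
by rewrite ltrD// distrC.
Qed.

Theorem theorem1p1 (R : realType) (a b : R) (hab : a < b)
    (M : nat -> R) (hM : weight_sequence M)
    (phi : segment a b -> segment a b)
    (hphi : induces_compact_endomorphism hab hM phi)
    (x0 : segment a b) (hx0 : phi x0 = x0) :
  `|deriv_on (fun x : segment a b => (val (phi x))%:C) x0| < 1.
Proof.
have [ephi cT] := hphi.
pose lambda := deriv_on (@valC R a b \o phi) x0; rewrite -/lambda.
rewrite real_ltNge ?normr_real ?real1//; apply/negP => l1.
have [f fP] := choice (fun k => near_extremal hab hM k x0).
pose T := comp_endo hab hM ephi.
have bB : bounded_set [set u : DX hab hM | `|u| <= 1].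
  by exists 1; split; [exact: real1|move=> r r1 u /= u1; exact: le_trans u1 (ltW r1)].
apply: (precompact_not_separated (u := T \o f) (cT _ bB)).
  by move=> n; exists (f n) => //=; have [] := fP n.
move=> m n mn; have [_ fm0 fmn fmP] := fP m; have [_ fn0 _ _] := fP n.
(* As [m < n], the derivatives of [f n] vanish up to order [m] included, so [T (f n)] does not
   contribute to the functional of order [m]. *)
have fn0m : vanishes_upto m.+1 x0 (f n) by move=> j jm; apply: fn0; exact: leq_trans mn.
have Tm0 := comp_endo_vanishes_upto ephi hx0 fm0.
have Tn0 := comp_endo_vanishes_upto ephi hx0 fn0m.
have gE : T (f m) - T (f n) = -1 *: T (f n) + T (f m) by rewrite scaleN1r addrC.
have g0 : vanishes_upto m x0 (T (f m) - T (f n)).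
  by move=> j jm; rewrite gE derivn_on_DX (Tm0 j jm) (Tn0 j (leqW jm)) mulr0 addr0.
(* Extremality of [f m] gives [|lambda|^m L <= 2 L |T (f m) - T (f n)|], where [L] is the modulus of
   the derivative of order [m] of [f m] at [x0]. Since [L > 0] and [|lambda|^m >= 1], the distance
   is at least 1/2. *)
have := fmP _ g0; rewrite {1}gE derivn_on_DX (Tn0 m (leqnn _)) mulr0 add0r.
rewrite (derivn_on_comp_endo ephi hx0 fm0) -/lambda normrM normrX.
have L0 : 0 < `|derivn_on m (f m) x0| by rewrite normr_gt0.
move=> H; have L20 : 0 < 2 * `|derivn_on m (f m) x0| by rewrite mulr_gt0.
rewrite -(ler_pM2l L20) mulrAC divff ?mul1r//.
by apply: le_trans H; rewrite ler_peMl// exprn_ege1.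
Qed.
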